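(* Let $R$ be a multiplicative hyperring with $Z(R)\subseteq J(R)$. If $I$ is an $r$-hyperideal of $R$, then $I$ is a $J$-prime hyperideal of $R$.
   Context: A multiplicative hyperring is a nonempty set $R$ with an operation $+$ and a hyperoperation $\circ: R\times R\to P^*(R)$ (where $P^*(R)$ is the set of nonempty subsets of $R$) such that: $(R,+)$ is an abelian group; $\circ$ is associative; $a\circ(b+c)\subseteq a\circ b+a\circ c$ and $(b+c)\circ a\subseteq b\circ a+c\circ a$; and $a\circ(-b)=(-a)\circ b=-(a\circ b)$ for all $a,b,c\in R$. For nonempty subsets $A,B\subseteq R$, $A\circ B=\bigcup_{x\in A,\,y\in B}x\circ y$, and $A\circ r=A\circ\{r\}$. Standing assumptions: $R$ is commutative with an identity $1$, meaning $a\in a\circ 1$ for all $a\in R$. A hyperideal of $R$ is a nonempty subset $I\subseteq R$ with $a-b\in I$ for $a,b\in I$ and $r\circ x\subseteq I$ for $x\in I$, $r\in R$. Let $\mathbf{C}=\{r_1\circ r_2\circ\cdots\circ r_n : r_i\in R,\ n\in\mathbb{N}\}$; a hyperideal $I$ is a $\mathbf{C}$-hyperideal if for every $A\in\mathbf{C}$, $A\cap I\neq\varnothing$ implies $A\subseteq I$. Standing assumption: all hyperideals are $\mathbf{C}$-hyperideals. A proper hyperideal $M$ is maximal if every hyperideal $N$ with $M\subsetneq N\subseteq R$ equals $R$; the Jacobson radical $J(R)$ is the intersection of all maximal hyperideals of $R$. An element $x\in R$ is a zero divisor if there is $0\neq y\in R$ with $x\circ y=\{0\}$; $Z(R)$ is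 the set of all zero divisors. For $x\in R$, $ann(x)=\{y\in R : x\circ y=\{0\}\}$. A proper hyperideal $I$ is an $r$-hyperideal if for all $x,y\in R$, $x\circ y\subseteq I$ and $ann(x)=\{0\}$ imply $y\in I$. A proper hyperideal $I$ is $J$-prime if for all $x,y\in R$, $x\circ y\subseteq I$ implies $x\in J(R)$ or $y\in I$.
   Formalization: The formal theorem additionally assumes x∘0 = {0} for all x in R; without it the claim fails, e.g. R = Z with x∘y = xy + 6Z and I = 6Z, where Z(R) and every ann(x) are empty, yet 2∘3 ⊆ I with 2 not in J(R) and 3 not in I. *)

(* Defs.v *)
From HB Require Import structures.
From mathcomp Require Import all_boot all_order all_algebra.
From mathcomp Require Import boolp classical_sets.

Set Implicit Arguments.
Unset Strict Implicit.
Unset Printing Implicit Defensive.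

Import GRing.Theory.
Local Open Scope classical_set_scope.
Local Open Scope ring_scope.

Definition set_add (V : zmodType) (A B : set V) : set V :=
  [set x + y | x in A & y in B].

Definition set_opp (V : zmodType) (A : set V) : set V := [set - x | x in A].

Definition set_hmul (T : Type) (op : T -> T -> set T) (A B : set T) : set T :=
  \bigcup_(x in A) \bigcup_(y in B) op x y.

HB.mixin Record isMultHyperring R of GRing.Zmodule R := {
  hmul : R -> R -> set R;
  hmul_nonempty : forall a b : R, hmul a b !=set0;
  hmulA : forall a b c : R,
    set_hmul hmul [set a] (hmul b c) = set_hmul hmul (hmul a b) [set c];
  hmulDr : forall a b c : R,
    hmul a (b + c) `<=` set_add (hmul a b) (hmul a c);
  hmulDl : forall a b c : R,
    hmul (b + c) a `<=` set_add (hmul b a) (hmul c a);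
  hmulrN : forall a b : R, hmul a (- b) = set_opp (hmul a b);
  hmulNr : forall a b : R, hmul (- a) b = set_opp (hmul a b)
}.

#[short(type="multHyperringType")]
HB.structure Definition MultHyperring :=
  {R of isMultHyperring R & GRing.Zmodule R}.

HB.mixin Record MultHyperring_isComUnital R of MultHyperring R := {
  hone : R;
  hmulC : forall a b : R, hmul a b = hmul b a;
  hmulr1 : forall a : R, hmul a hone a
}.

#[short(type="comMultHyperringType")]
HB.structure Definition ComMultHyperring :=
  {R of MultHyperring_isComUnital R & MultHyperring R}.

Section Hyperideals.
Variable R : comMultHyperringType.
Implicit Types (x y r : R) (A I M N : set R).

Definition hyperideal I : Prop :=
  [/\ I !=set0,
      forall a b, I a -> I b -> I (a - b)
    & forall r x, I x -> hmul r x `<=` I].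

Definition proper_hyperideal I : Prop := hyperideal I /\ I <> setT.

Definition hprod (r : R) (rs : seq R) : set R :=
  foldl (fun A s => set_hmul hmul A [set s]) [set r] rs.

Definition finite_hyperproducts : set (set R) :=
  [set A | exists r rs, A = hprod r rs].

Definition C_hyperideal I : Prop :=
  hyperideal I /\
  forall A, finite_hyperproducts A -> A `&` I !=set0 -> A `<=` I.

Definition maximal_hyperideal M : Prop :=
  proper_hyperideal M /\ forall N, hyperideal N -> M `<` N -> N = setT.

(* The axioms do not make 0 absorbing: if L is an ideal of a commutative ring
   then x o y := x y + L satisfies them all, with x o 0 = L.  When L != 0 every
   ann x is empty, so that no ann x equals {0} although no x is a zero divisor.
   Hence [ann x = [set 0]] means "no nonzero annihilating element" only
   under the convention x o 0 = {0}. *)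
Definition ann x : set R := [set y | hmul x y = [set 0]].

Definition r_hyperideal I : Prop :=
  proper_hyperideal I /\
  forall x y, hmul x y `<=` I -> ann x = [set 0] -> I y.

End Hyperideals.

Definition jacobson (R : comMultHyperringType) : set R :=
  \bigcap_(M in [set M : set R | maximal_hyperideal M]) M.

Arguments jacobson : clear implicits.

Definition zero_divisors (R : comMultHyperringType) : set R :=
  [set x | exists2 y : R, y != 0 & hmul x y = [set 0]].

Arguments zero_divisors : clear implicits.

Definition J_prime_hyperideal (R : comMultHyperringType) (I : set R) : Prop :=
  proper_hyperideal I /\
  forall x y : R, hmul x y `<=` I -> jacobson R x \/ I y.

(* Main.v *)
Require Import Defs.
From HB Require Import structures.
From mathcomp Require Import all_boot all_order all_algebra.
From mathcomp Require Import boolp classical_sets.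

(** The proof is a dichotomy on the first factor: an element of [R] either is a
    zero divisor, hence lies in the Jacobson radical by hypothesis, or is
    annihilated by [0] alone ([ann_nonzero_divisor]), in which case the defining
    property of an r-hyperideal moves the second factor into [I]. *)

Set Implicit Arguments.
Unset Strict Implicit.
Unset Printing Implicit Defensive.

Import GRing.Theory.
Local Open Scope classical_set_scope.
Local Open Scope ring_scope.

(** Not being a zero divisor only bounds the annihilator from above by [{0}];
    the absorption hypothesis is what puts [0] into it, since the hyperring
    axioms would allow an empty annihilator. *)
Lemma ann_nonzero_divisor (R : comMultHyperringType) (x : R) :
  hmul x 0 = [set 0] -> ~ zero_divisors R x -> ann x = [set 0].
Proof.
move=> x0 nzdx; apply/seteqP; split=> [y xy0 | _ ->]; last exact: x0.
by apply: contrapT => /eqP y0; apply: nzdx; exists y.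
Qed.

Theorem theorem3p9 (R : comMultHyperringType)
    (hC : forall K : set R, hyperideal K -> C_hyperideal K)
    (h0 : forall x : R, hmul x 0 = [set 0])
    (hZJ : zero_divisors R `<=` jacobson R)
    (I : set R) (hI : r_hyperideal I) :
  J_prime_hyperideal I.
Proof.
case: hI => properI rI; split=> // x y xyI.
have [zdx | nzdx] := pselect (zero_divisors R x); first by left; exact: hZJ.
by right; apply: rI xyI _; exact: ann_nonzero_divisor.
Qed.
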